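(* Let $f, h_1,\dots,h_p, g_1,\dots,g_m:\mathbb{R}^n\to\mathbb{R}$ be twice continuously differentiable and consider the problem (NLP) of minimizing $f(x)$ over $x\in\mathbb{R}^n$ subject to $h_j(x)=0$ ($j=1,\dots,p$) and $g_i(x)\le 0$ ($i=1,\dots,m$). If $\bar x$ is a local minimizer of (NLP), then $\bar x$ satisfies the $\tilde S$-SAKKT2 conditions for (NLP).
   Context: Write $h=(h_1,\dots,h_p)$, $g=(g_1,\dots,g_m)$; $\|\cdot\|$ is the Euclidean norm; $\max$ and $\min$ of vectors are taken componentwise. For $x\in\mathbb{R}^n$, $A(x)=\{i\in\{1,\dots,m\}: g_i(x)=0\}$. The Lagrangian is $L(x,\mu,\omega)=f(x)+h(x)^\top\mu+g(x)^\top\omega$ for $x\in\mathbb{R}^n$, $\mu\in\mathbb{R}^p$, $\omega\in\mathbb{R}^m_+$. The notation $\varepsilon_k\searrow 0$ means that the positive scalars $\varepsilon_k$ converge monotonically to $0$. A sequence $\{(x^k,\mu^k,\omega^k,\varepsilon_k)\}\subseteq\mathbb{R}^n\times\mathbb{R}^p\times\mathbb{R}^m_+\times(0,\infty)$ with $x^k\to\bar x$ and $\varepsilon_k\searrow 0$ satisfies AKKT (approximate KKT) if for all $k$: (i) $\big\|\nabla f(x^k)+\sum_{j=1}^p\mu_j^k\nabla h_j(x^k)+\sum_{i=1}^m\omega_i^k\nabla g_i(x^k)\big\|\le\varepsilon_k$; (ii) $\|h(x^k)\|\le\varepsilon_k$; (iii) $\|\max\{0,g(x^k)\}\|\le\varepsilon_k$;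 (iv) $\|\min\{\omega^k,-g(x^k)\}\|\le\varepsilon_k$. $\tilde S$-SAKKT2: $\bar x$ satisfies $\tilde S$-SAKKT2 if there exists a sequence $\{(x^k,\mu^k,\omega^k,\varepsilon_k)\}\subseteq\mathbb{R}^n\times\mathbb{R}^p\times\mathbb{R}^m_+\times(0,\infty)$ with $x^k\to\bar x$, $\varepsilon_k\searrow0$, satisfying AKKT and $d^\top\nabla^2_{xx}L(x^k,\mu^k,\omega^k)d\ge-\varepsilon_k\|d\|^2$ for all $d\in\tilde S(x^k,\bar x,\omega^k)$, where $\tilde S(y,x,\omega)$ is the set of $d\in\mathbb{R}^n$ such that $\nabla h_j(y)^\top d=0$ for $j=1,\dots,p$ and $\nabla g_i(y)^\top d=0$ for $i\in A(x)$ with $\omega_i>0$. *)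

(* Defs.v *)
From HB Require Import structures.
From mathcomp Require Import all_boot all_order all_algebra.
From mathcomp Require Import all_classical all_reals all_analysis.

Set Implicit Arguments.
Unset Strict Implicit.
Unset Printing Implicit Defensive.

Import Order.TTheory GRing.Theory Num.Theory.
Import numFieldNormedType.Exports.

Local Open Scope classical_set_scope.
Local Open Scope ring_scope.

(* Vectors are row vectors.  The canonical norm of 'rV[R]_n is the sup norm,
   which provides the topology; the Euclidean norm is defined here. *)
Definition dot (R : realType) (n : nat) (u v : 'rV[R]_n) : R :=
  \sum_(i < n) u 0 i * v 0 i.

Definition enorm (R : realType) (n : nat) (u : 'rV[R]_n) : R :=
  Num.sqrt (dot u u).

Definition grad (R : realType) (n : nat) (f : 'rV[R]_n -> R) (x : 'rV[R]_n) :
  'rV[R]_n := \row_i 'D_(delta_mx 0 i) f x.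

Definition hess (R : realType) (n : nat) (f : 'rV[R]_n -> R) (x : 'rV[R]_n) :
  'M[R]_n := 'J (grad f) x.

(* [continuous (hess f)] is about the topology of 'M[R]_n, that is, entrywise
   continuity; continuity of f and of its gradient follow from
   differentiability. *)
Definition twice_cont_diff (R : realType) (n : nat) (f : 'rV[R]_n -> R) : Prop :=
  [/\ forall x, differentiable f x,
      forall x, differentiable (grad f) x
    & continuous (hess f)].

Section NLP.
Context (R : realType) (n p m : nat).
Variables (f : 'rV[R]_n -> R) (h : 'I_p -> 'rV[R]_n -> R)
  (g : 'I_m -> 'rV[R]_n -> R).

Definition feasible : set 'rV[R]_n :=
  [set x | (forall j, h j x = 0) /\ (forall i, g i x <= 0)].

Definition local_minimizer (x : 'rV[R]_n) : Prop :=
  feasible x /\ \forall y \near x, feasible y -> f x <= f y.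

Definition active_set (x : 'rV[R]_n) : {set 'I_m} := [set i | g i x == 0]%SET.

Definition lagrangian (x : 'rV[R]_n) (mu : 'rV[R]_p) (omega : 'rV[R]_m) : R :=
  f x + \sum_(j < p) h j x * mu 0 j + \sum_(i < m) g i x * omega 0 i.

Definition AKKT_at (x : 'rV[R]_n) (mu : 'rV[R]_p) (omega : 'rV[R]_m) (eps : R) :
    Prop :=
  [/\ enorm (grad f x + \sum_(j < p) mu 0 j *: grad (h j) x
               + \sum_(i < m) omega 0 i *: grad (g i) x) <= eps,
      enorm (\row_(j < p) h j x) <= eps,
      enorm (\row_(i < m) Num.max 0 (g i x)) <= eps
    & enorm (\row_(i < m) Num.min (omega 0 i) (- g i x)) <= eps].

Definition Stilde (y x : 'rV[R]_n) (omega : 'rV[R]_m) : set 'rV[R]_n :=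
  [set d | (forall j, dot (grad (h j) y) d = 0) /\
           (forall i, i \in active_set x -> 0 < omega 0 i ->
              dot (grad (g i) y) d = 0)].

Definition Stilde_SAKKT2 (xbar : 'rV[R]_n) : Prop :=
  exists (x : nat -> 'rV[R]_n) (mu : nat -> 'rV[R]_p) (omega : nat -> 'rV[R]_m)
         (eps : nat -> R),
    [/\ (forall k i, 0 <= omega k 0 i) /\ (forall k, 0 < eps k),
        x @ \oo --> xbar,
        nonincreasing_seq eps /\ eps @ \oo --> (0 : R),
        forall k, AKKT_at (x k) (mu k) (omega k) (eps k)
      & forall k d, Stilde (x k) xbar (omega k) d ->
          (d *m hess (fun z => lagrangian z (mu k) (omega k)) (x k) *m d^T) 0 0
            >= - eps k * enorm d ^+ 2].

End NLP.

(* Main.v *)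
Require Import Defs.
From mathcomp Require Import all_boot all_order all_algebra.
From mathcomp Require Import all_classical all_reals all_analysis.
From mathcomp Require Import ring lra.

(** The proof is by exterior penalization, with two choices that matter: a
    quartic proximal term and a cubic penalty of the inequalities.

    Near the local minimizer [xbar], minimize
      [f x + sum_i (x_i - xbar_i)^4
         + k (sum_j h_j(x)^2 + sum_i max(0,g_i(x))^3)]
    over a small closed ball.  The quartic term makes [xbar] a strict local
    minimizer, so for [k] large the penalized function exceeds [f xbar] on the
    whole boundary sphere ([penalty_sphere], a compactness argument), and its
    minimizer [x] is interior ([penalty_interior_min]).  The quartic term has
    gradient and Hessian as small as one likes on a small ball, so it only
    contributes to the error.

    The inequality penalty is cubic rather than quadratic because
    [max(0,t)^3] is twice differentiable.  The first- and second-order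
    necessary conditions therefore hold at [x] for the penalized function, and
    with [mu_j = 2 k h_j(x)] and [omega_i = 3 k max(0,g_i(x))^2] they read
    ([penalized_local_min])
      [grad_x L = - (4 (x_i - xbar_i)^3)_i]   and
      [d^T hess_x L d + 12 sum_i (x_i - xbar_i)^2 d_i^2
         + k (2 sum_j (grad h_j . d)^2
              + 6 sum_i max(0,g_i(x)) (grad g_i . d)^2) >= 0].
    The last bracket vanishes for [d] in [Stilde]: [omega_i > 0] exactly when
    [max(0,g_i(x)) > 0], and such an [i] is active at [xbar] when [x] is close
    to [xbar].  A quadratic penalty would instead leave a positive curvature
    term for the indices with [g_i(x) = 0] and [omega_i = 0], on which [Stilde]
    puts no constraint.  The complementarity residual [min(omega_i,-g_i(x))]
    has absolute value [max(0,g_i(x))], which is small near [xbar].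

    This gives, for each positive [eps], one point with multipliers satisfying
    the conditions with error [eps] and lying within [eps] of [xbar]
    ([near_SAKKT2]); the sequence is obtained by taking
    [eps_k = 1 / (k + 1)].

    All derivatives are computed along lines: [jet2 u a b c] records the value
    and first two derivatives at 0 of a function of one real variable, and
    these triples obey a calculus under sums and compositions.  Uniqueness of
    the triple also yields the Hessian of the Lagrangian. *)

Set Implicit Arguments.
Unset Strict Implicit.
Unset Printing Implicit Defensive.

Import Order.TTheory GRing.Theory Num.Theory.
Import numFieldNormedType.Exports.

Local Open Scope classical_set_scope.
Local Open Scope ring_scope.

(** * Second-order jets of functions of one variable *)

(** The first derivative is required at every point, not only at 0: this makes
    it a well-defined function, whose own derivative at 0 is [c]. *)
Definition jet2 (R : realType) (u : R -> R) (a b c : R) :=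
  u 0 = a /\ exists u1 : R -> R,
    [/\ forall t : R, is_derive t 1 u (u1 t), u1 0 = b
      & is_derive (0 : R) 1 u1 c].

Section Jet.
Variable R : realType.
Implicit Types (u v : R -> R) (a b c k : R).

Lemma is_derive_unique u (x v d d' : R) :
  is_derive x v u d -> is_derive x v u d' -> d = d'.
Proof. by move=> [_ <-] [_ <-]. Qed.

Lemma is_derive_continuous u (x d : R) :
  is_derive x 1 u d -> {for x, continuous u}.
Proof.
move=> [du _]; apply: differentiable_continuous; exact/derivable1_diffP.
Qed.

Lemma jet2_unique u a b c a' b' c' :
  jet2 u a b c -> jet2 u a' b' c' -> [/\ a = a', b = b' & c = c'].
Proof.
move=> [<- [u1 [d1 <- e1]]] [<- [u2 [d2 <- e2]]].
have E : u1 = u2.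
  by apply/funext => t; exact: is_derive_unique (d1 t) (d2 t).
split=> //; rewrite ?E //; rewrite E in e1.
exact: is_derive_unique e1 e2.
Qed.

Lemma jet2_cst k : jet2 (fun=> k) k 0 0.
Proof.
by split=> //; exists (fun=> 0); split=> // [t|]; exact: is_derive_cst.
Qed.

Lemma jet2_add u v a b c a' b' c' : jet2 u a b c -> jet2 v a' b' c' ->
  jet2 (fun t => u t + v t) (a + a') (b + b') (c + c').
Proof.
move=> [<- [u1 [d1 <- e1]]] [<- [u2 [d2 <- e2]]].
split=> //; exists (fun t => u1 t + u2 t); split=> // [t|].
- exact: (is_deriveD (d1 t) (d2 t)).
- exact: (is_deriveD e1 e2).
Qed.

Lemma jet2_scale k u a b c : jet2 u a b c ->
  jet2 (fun t => k * u t) (k * a) (k * b) (k * c).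
Proof.
move=> [<- [u1 [d1 <- e1]]]; split=> //.
exists (fun t => k * u1 t); split=> // [t|].
- exact: (is_deriveZ k (d1 t)).
- exact: (is_deriveZ k e1).
Qed.

Lemma jet2_sum (I : finType) (u : I -> R -> R) (a b c : I -> R) :
  (forall i, jet2 (u i) (a i) (b i) (c i)) ->
  jet2 (fun t => \sum_i u i t) (\sum_i a i) (\sum_i b i) (\sum_i c i).
Proof.
move=> J; elim: (index_enum I) => [|i s IH].
  rewrite !big_nil; under eq_fun do rewrite big_nil; exact: jet2_cst.
rewrite !big_cons; under eq_fun do rewrite big_cons; exact: jet2_add.
Qed.

Lemma jet2_comp (r r1 : R -> R) r2 u a b c :
  (forall s : R, is_derive s 1 r (r1 s)) -> is_derive a 1 r1 r2 ->
  jet2 u a b c ->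
  jet2 (fun t => r (u t)) (r a) (r1 a * b) (r2 * b ^+ 2 + r1 a * c).
Proof.
move=> dr dr1 [ua [u1 [d1 <- e1]]]; split; first by rewrite ua.
exists (fun t => r1 (u t) * u1 t); split; last 2 first.
- by rewrite ua.
- rewrite -ua in dr1.
  have D := is_deriveM (is_derive1_comp dr1 (d1 0)) e1.
  apply: is_derive_eq D _ => /=.
  by rewrite /GRing.scale /= ua; ring.
- by move=> t; exact: (is_derive1_comp (dr _) (d1 t)).
Qed.

(** If the second derivative were negative at a critical point, the first
    derivative would be negative just to the right of 0, and the mean value
    theorem would make [u] decrease there. *)
Lemma jet2_local_min u a b c : jet2 u a b c ->
  (\forall t \near (0 : R), u 0 <= u t) -> b = 0 /\ 0 <= c.
Proof.
move=> [_ [u1 [d1 <- e1]]] /nbhs_ballP[e /= e0 umin].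
have um t : `|t| < e -> u 0 <= u t.
  by move=> te; apply: umin; rewrite -ball_normE /ball_ /= sub0r normrN.
have b0 : u1 0 = 0.
  have D : is_derive (0 : R) 1 u 0.
    apply: (@derive1_at_min _ u (- e) e) => [|t _||t].
    - by rewrite ge0_cp // ltW.
    - exact: (@ex_derive _ _ _ _ _ _ _ (d1 t)).
    - by rewrite in_itv /= oppr_lt0 e0.
    - by rewrite in_itv /= => ?; rewrite um // ltr_norml.
  exact: is_derive_unique (d1 0) D.
split=> //; rewrite leNgt; apply/negP => c0.
have : (fun h => h^-1 *: ((u1 \o shift 0) (h *: 1) - u1 0)) @ 0^' --> c.
  rewrite -(@derive_val _ _ _ _ _ _ _ e1).
  exact: (@ex_derive _ _ _ _ _ _ _ e1).
move=> /cvgr_lt/(_ 0 c0)[s /= s0 sP].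
have u1neg (t : R) : 0 < t -> t < s -> u1 t < 0.
  move=> t0 ts; have := sP t.
  rewrite /ball_ /= sub0r normrN gtr0_norm // => /(_ ts (lt0r_neq0 t0)).
  by rewrite b0 subr0 addr0 /GRing.scale /= mulr1 pmulr_rlt0 ?invr_gt0.
pose t := Num.min s e / 2.
have m0 : 0 < Num.min s e by rewrite lt_min s0.
have t0 : 0 < t by rewrite divr_gt0.
have tm : t < Num.min s e by rewrite /t ltr_pdivrMr // ltr_pMr // ltr1n.
have [|x] := MVT t0 (fun x _ => d1 x).
  apply: continuous_subspaceT => x; exact: is_derive_continuous (d1 x).
rewrite in_itv /= subr0 => /andP[x0 xt] E.
move: tm; rewrite lt_min => /andP[ts te].
have : u t - u 0 < 0 by rewrite E nmulr_rlt0 // u1neg // (lt_trans xt).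
by rewrite ltNge subr_ge0 um // gtr0_norm.
Qed.

(** * A twice differentiable penalty for inequalities *)

(** A quadratic error bound gives differentiability without any case analysis
    on the sign of the increment; it is how the kink of [pospart] at 0 is
    handled below. *)
Lemma is_derive_quadratic (f : R -> R) a x C :
  (forall y, `|f y - f x - a * (y - x)| <= C * (y - x) ^+ 2) ->
  is_derive (x : R) 1 f a.
Proof.
move=> H.
have L : (fun h => h^-1 *: ((f \o shift x) (h *: 1) - f x)) @ 0^' --> a.
  apply/cvgrPdist_le => e e0.
  have C0 : 0 < `|C| + 1 by rewrite ltr_wpDl.
  exists (e / (`|C| + 1)); first exact: divr_gt0.
  move=> h /=; rewrite sub0r normrN ltr_pdivlMr // => he h0.
  have hp : 0 < `|h| by rewrite normr_gt0.
  rewrite -(ler_pM2l hp) -normrM /= /GRing.scale /= mulr1 mulrBr mulVKf //.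
  have Hh := H (h + x); rewrite addrK (mulrC a) distrC in Hh.
  apply: le_trans Hh _.
  rewrite -real_normK ?num_real // mulrC expr2 -mulrA ler_pM2l //.
  apply: le_trans (ltW he); rewrite ler_pM2l //.
  by rewrite (le_trans (ler_norm _)) // lerDl.
split; first by apply/cvg_ex; exists a.
exact: cvg_lim L.
Qed.

Definition pospart (t : R) := Num.max 0 t.

Lemma pospart_ge0 (t : R) : 0 <= pospart t.
Proof. by rewrite le_max lexx. Qed.

(** The square of the positive part is convex with 2-Lipschitz derivative, hence
    the constant 1 in the quadratic bound. *)
Lemma is_derive_pospart_sqr (x : R) :
  is_derive x 1 (fun t => pospart t ^+ 2) (2 * pospart x).
Proof.
apply: (@is_derive_quadratic _ _ _ 1) => y.
rewrite ler_norml /pospart.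
(* In the mixed-sign cases the bound rests on [x * y <= 0]. *)
case: (leP 0 x) => x0; case: (leP 0 y) => y0; apply/andP; split.
all: try have xy := mulr_ge0_le0 x0 (ltW y0).
all: try have xy := mulr_le0_ge0 (ltW x0) y0.
all: have yy := sqr_ge0 y; have yx := sqr_ge0 (y - x); nra.
Qed.

(** Writing the cube as [t * pospart t ^+ 2] reduces it to the square by the
    product rule. *)
Lemma is_derive_pospart_cube (x : R) :
  is_derive x 1 (fun t => pospart t ^+ 3) (3 * pospart x ^+ 2).
Proof.
have -> : (fun t => pospart t ^+ 3) = id * (fun t => pospart t ^+ 2).
  apply/funext => t; rewrite /pospart [RHS]/GRing.mul /=.
  by case: (leP 0 t) => ?; [rewrite exprS|rewrite !expr0n /= mulr0].
apply: is_derive_eq (is_deriveM (is_derive_id _ _) (is_derive_pospart_sqr x)) _.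
rewrite /GRing.scale /= /pospart.
by case: (leP 0 x) => ?; ring.
Qed.

Lemma is_derive_exp (m : nat) (x : R) :
  is_derive x 1 (fun t => t ^+ m.+1) (m.+1%:R * x ^+ m).
Proof.
by have := is_deriveX m.+1 (is_derive_id x (1 : R)); rewrite [_ *: 1]mulr1 fctE.
Qed.

Lemma jet2_exp (m : nat) u a b c : jet2 u a b c ->
  jet2 (fun t => u t ^+ m.+2) (a ^+ m.+2) (m.+2%:R * a ^+ m.+1 * b)
    (m.+2%:R * (m.+1%:R * a ^+ m) * b ^+ 2 + m.+2%:R * a ^+ m.+1 * c).
Proof.
apply: (jet2_comp (is_derive_exp m.+1)).
exact: is_deriveZ (is_derive_exp m a).
Qed.

Lemma jet2_pospart_cube u a b c : jet2 u a b c ->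
  jet2 (fun t => pospart (u t) ^+ 3) (pospart a ^+ 3) (3 * pospart a ^+ 2 * b)
    (3 * (2 * pospart a) * b ^+ 2 + 3 * pospart a ^+ 2 * c).
Proof.
apply: (jet2_comp is_derive_pospart_cube).
exact: is_deriveZ (is_derive_pospart_sqr a).
Qed.

Lemma jet2_affine a b : jet2 (fun t => a + t * b) a b 0.
Proof.
split; first by rewrite mul0r addr0.
exists (fun=> b); split=> // [t|]; last exact: is_derive_cst.
have := is_deriveD (is_derive_cst a t (1 : R))
  (is_deriveZ b (is_derive_id t (1 : R))).
rewrite add0r [_ *: 1]mulr1; congr (is_derive _ _ _ _).
by apply/funext => s; rewrite /cst fctE [RHS]addrC mulrC addrC.
Qed.

End Jet.

(** * Functions of several variables along a line *)

Section Multi.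
Variables (R : realType) (n : nat).
Implicit Types (f g : 'rV[R]_n -> R) (x d u v w : 'rV[R]_n) (k : R).

Definition qform (A : 'M[R]_n) d : R := (d *m A *m d^T) 0 0.

(** What second-order jets along lines see of a function; stable under linear
    combinations, as the Lagrangian requires. *)
Definition twice_diff f :=
  (forall x, differentiable f x) /\ (forall x, differentiable (grad f) x).

Lemma twice_cont_diffW f : twice_cont_diff f -> twice_diff f.
Proof. by case. Qed.

Lemma twice_diff_continuous f : twice_diff f -> continuous f.
Proof. by move=> df x; apply: differentiable_continuous; exact: df.1. Qed.

Lemma dotDl u v w : dot (u + v) w = dot u w + dot v w.
Proof. by rewrite -big_split /=; apply: eq_bigr => i _; rewrite mxE mulrDl. Qed.

Lemma dotZl k u w : dot (k *: u) w = k * dot u w.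
Proof. by rewrite mulr_sumr; apply: eq_bigr => i _; rewrite mxE mulrA. Qed.

Lemma dot0l w : dot 0 w = 0.
Proof. by rewrite /dot big1 // => i _; rewrite mxE mul0r. Qed.

Lemma dot_suml (I : finType) (u : I -> 'rV[R]_n) w :
  dot (\sum_i u i) w = \sum_i dot (u i) w.
Proof.
by apply: (big_morph (fun u => dot u w)) => [u1 u2|]; rewrite (dotDl, dot0l).
Qed.

Lemma dot_eq0 u : (forall d, dot u d = 0) -> u = 0.
Proof.
move=> u0; apply/rowP => i; rewrite mxE; have := u0 (delta_mx 0 i).
rewrite /dot (bigD1 i) //= big1 => [|j ji]; rewrite mxE eqxx /=.
  by rewrite eqxx mulr1 addr0.
by rewrite (negbTE ji) mulr0.
Qed.

Lemma derive_dot_grad f x d : differentiable f x -> 'D_d f x = dot (grad f x) d.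
Proof.
move=> fx; rewrite deriveE // {1}(row_sum_delta d) linear_sum.
by apply: eq_bigr => i _; rewrite linearZ mxE deriveE // mulrC.
Qed.

(** The difference quotients of both sides are the same function of [h]. *)
Lemma is_derive_line (W : normedModType R) (F : 'rV[R]_n -> W) x d (t : R) dF :
  is_derive (x + t *: d) d F dF ->
  is_derive t 1 (fun t => F (x + t *: d)) dF.
Proof.
have E : (fun h : R => h^-1 *: ((F \o shift (x + t *: d)) (h *: d) -
                                F (x + t *: d))) =
  (fun h : R => h^-1 *: (((fun t => F (x + t *: d)) \o shift t) (h *: 1) -
                                F (x + t *: d))).
  apply/funext => h /=; congr (_ *: (F _ - _)).
  by rewrite [h *: 1]mulr1 scalerDl addrCA.
by rewrite /derivable /derive => -[]; rewrite /derivable /derive E => ? ?.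
Qed.

(** The slope of [f] along the line is [dot (grad f (x + t d)) d]; its own slope
    at 0 is the directional derivative of the gradient, that is a row of
    [d *m hess f x], paired with [d]. *)
Lemma jet2_line f x d : twice_diff f ->
  jet2 (fun t => f (x + t *: d)) (f x) (dot (grad f x) d) (qform (hess f x) d).
Proof.
move=> [df dgf]; split; first by rewrite scale0r addr0.
exists (fun t => dot (grad f (x + t *: d)) d); split.
- move=> t; apply: is_derive_line; rewrite -derive_dot_grad //.
  by apply: derivableP; exact: diff_derivable.
- by rewrite scale0r addr0.
have D i : is_derive (0 : R) 1 (fun t => d 0 i * grad f (x + t *: d) 0 i)
    ((d *m hess f x) 0 i * d 0 i).
  have Dx : derivable (grad f) (x + 0 *: d) d by exact: diff_derivable.
  have := @is_derive_line _ (fun y => grad f y 0 i) x d 0 _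
    (derivableP ((derivable_mxP _ _ _).1 Dx 0 i)).
  move=> /(is_deriveZ (d 0 i)) /is_derive_eq; apply.
  rewrite /hess -deriveEjacobian // derive_mx ?mxE; last first.
    by move: Dx; rewrite scale0r addr0.
  by rewrite scale0r addr0 /GRing.scale /= mulrC.
have := is_derive_sum D.
have -> : \sum_(i < n) (fun t => d 0 i * grad f (x + t *: d) 0 i) =
   (fun t : R => dot (grad f (x + t *: d)) d).
  apply/funext => t; rewrite fct_sumE /dot.
  by apply: eq_bigr => i _; rewrite mulrC.
have -> // : \sum_(i < n) (d *m hess f x) 0 i * d 0 i = qform (hess f x) d.
by rewrite /qform [RHS]mxE; apply: eq_bigr => i _; rewrite [d^T _ _]mxE.
Qed.

Lemma gradD f g x : differentiable f x -> differentiable g x ->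
  grad (fun y => f y + g y) x = grad f x + grad g x.
Proof.
move=> fx gx; apply/rowP => i.
by rewrite !mxE deriveD //; exact: diff_derivable.
Qed.

Lemma gradZ k f x : differentiable f x ->
  grad (fun y => k * f y) x = k *: grad f x.
Proof.
by move=> fx; apply/rowP => i; rewrite !mxE deriveZ //; exact: diff_derivable.
Qed.

Lemma twice_diffD f g : twice_diff f -> twice_diff g ->
  twice_diff (fun y => f y + g y).
Proof.
move=> [df ddf] [dg ddg]; split=> x; first exact: differentiableD.
have -> : grad (fun y => f y + g y) = grad f + grad g.
  by apply/funext => y; rewrite gradD.
exact: differentiableD.
Qed.

Lemma twice_diffZ k f : twice_diff f -> twice_diff (fun y => k * f y).
Proof.
move=> [df ddf]; split=> x; first exact: differentiableZ.
have -> : grad (fun y => k * f y) = k *: grad f.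
  by apply/funext => y; rewrite gradZ.
exact: differentiableZ.
Qed.

Lemma twice_diff0 : twice_diff (fun=> 0).
Proof.
split=> x; first exact: differentiable_cst.
have -> : grad (fun=> 0) = (fun=> 0) :> ('rV[R]_n -> 'rV[R]_n).
  by apply/funext => z; apply/rowP => i; rewrite !mxE derive_cst.
exact: differentiable_cst.
Qed.

Lemma twice_diff_sum (I : finType) (F : I -> 'rV[R]_n -> R) :
  (forall i, twice_diff (F i)) -> twice_diff (fun y => \sum_i F i y).
Proof.
move=> dF; elim: (index_enum I) => [|i s IH].
  by under eq_fun do rewrite big_nil; exact: twice_diff0.
under eq_fun do rewrite big_cons; exact: twice_diffD.
Qed.

End Multi.

(** * The Euclidean norm *)

(** Cruder than the sharp factor [1 / sqrt q], but free of roots and of a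
    separate treatment of [q = 0]. *)
Lemma enorm_le (R : realType) (q : nat) (v : 'rV[R]_q) (e : R) : 0 <= e ->
  (forall i, `|v 0 i| <= e / q.+1%:R) -> enorm v <= e.
Proof.
move=> e0 ve; rewrite /enorm -[leRHS]ger0_norm // -sqrtr_sqr ler_wsqrtr //.
have q0 : 0 < q.+1%:R :> R by rewrite ltr0n.
apply: (@le_trans _ _ (\sum_(i < q) (e ^+ 2 / q.+1%:R))).
  apply: ler_sum => i _; rewrite -expr2 -real_normK ?num_real //.
  apply: le_trans (_ : (e / q.+1%:R) ^+ 2 <= _).
    by rewrite ler_sqr ?nnegrE // divr_ge0 // ltW.
  rewrite expr_div_n ler_wpM2l ?sqr_ge0 // lef_pV2 ?posrE ?exprn_gt0 //.
  by rewrite ler_eXnr // ler1n.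
rewrite sumr_const card_ord -[leLHS]mulr_natr -[leLHS]mulrA.
rewrite ler_piMr ?sqr_ge0 //.
by rewrite mulrC ler_pdivrMr // mul1r ler_nat.
Qed.

Lemma enorm_sqr (R : realType) (q : nat) (v : 'rV[R]_q) :
  enorm v ^+ 2 = \sum_i v 0 i ^+ 2.
Proof.
rewrite /enorm sqr_sqrtr; first by apply: eq_bigr => i _; rewrite expr2.
by apply: sumr_ge0 => i _; rewrite -expr2 sqr_ge0.
Qed.

(** * Interior minimizers of penalized functions *)

Section Penalty.
Variables (R : realType) (n : nat).
Implicit Types (F P : 'rV[R]_n -> R) (x y : 'rV[R]_n).

Lemma coord_le_norm x i : `|x 0 i| <= `|x|.
Proof.
rewrite [leRHS]/Num.Def.normr /= mx_normrE.
exact: (le_bigmax _ (fun k : 'I_1 * 'I_n => `|x k.1 k.2|) (0, i)).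
Qed.

Lemma continuous_sum (I : finType) (F : I -> 'rV[R]_n -> R) :
  (forall i, continuous (F i)) -> continuous (fun x => \sum_i F i x).
Proof.
move=> cF; elim: (index_enum I) => [|i s IH].
  have -> : (fun x => \sum_(i <- [::]) F i x) = fun=> 0.
    by apply/funext => x; rewrite big_nil.
  exact: cst_continuous.
have -> : (fun x => \sum_(j <- i :: s) F j x) =
          (fun x => F i x + \sum_(j <- s) F j x).
  by apply/funext => x; rewrite big_cons.
by move=> x; apply: continuousD; [exact: cF|exact: IH].
Qed.

Lemma continuous_dist x0 : continuous (fun x => `|x - x0|).
Proof.
move=> x; apply: (@continuous_comp _ _ _ (fun y => y - x0) Num.Def.normr).
  by apply: continuousB; [exact: cvg_id|exact: cst_continuous].
exact: norm_continuous.
Qed.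

(** Each point of the sphere has a neighbourhood on which the inequality holds
    for all large [k]: if [P x = 0] because [F] alone suffices, and if [P x > 0]
    because [k * P] grows without bound while [F] stays bounded below.
    Compactness makes the threshold on [k] uniform. *)
Lemma penalty_sphere F P x0 (e : R) :
    continuous F -> continuous P -> (forall x, 0 <= P x) ->
    (forall x, `|x - x0| = e -> P x = 0 -> F x0 < F x) ->
  exists2 k, 0 < k & forall x, `|x - x0| = e -> F x0 < F x + k * P x.
Proof.
move=> cF cP P0 FP.
have cS : compact [set x | `|x - x0| = e].
  apply: bounded_closed_compact.
    exists (`|x0| + e); split; first exact: num_real.
    move=> M /ltW eM x /= xe; apply: le_trans eM.
    by rewrite -(subrK x0 x) (le_trans (ler_normD _ _)) // xe addrC.
  have -> : [set x | `|x - x0| = e] = (fun x => `|x - x0|) @^-1` [set e] by [].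
  apply: preimage_closed; last exact: closed_eq.
  by move=> x _; exact: continuous_dist.
have NC := (compact_near_coveringP _).1 cS R (pinfty_nbhs R)
  (fun k x => F x0 < F x + k * P x) _.
have {NC} [x xe|M [Mr MP]] := NC.
  have [Px0|Px0] := pselect (P x = 0).
    have Fn : \forall y \near x, F x0 < F y.
      exact: cvgr_gt _ (cF x) _ (FP x xe Px0).
    exists ([set y | F x0 < F y], [set k | 0 < k]).
      by split=> //; apply: nbhs_pinfty_gt; exact: num_real.
    move=> [y k] /= [Fy k0].
    by rewrite (lt_le_trans Fy) // lerDl mulr_ge0 // ltW.
  have Pp : 0 < P x by rewrite lt_neqAle P0 eq_sym andbT; apply/eqP.
  have Pn : \forall y \near x, P x / 2 < P y.
    by apply: (cvgr_gt _ (cP x)); rewrite ltr_pdivrMr // ltr_pMr // ltr1n.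
  have Fn : \forall y \near x, F x - 1 < F y.
    by apply: (cvgr_gt _ (cF x)); rewrite gtrBl.
  pose K := `|F x0 - F x + 1| / (P x / 2).
  exists ([set y | P x / 2 < P y /\ F x - 1 < F y], [set k | K < k]).
    by split; [exact: filterI|apply: nbhs_pinfty_gt; exact: num_real].
  move=> [y k] /= [[Py Fy] Kk].
  have p2 : 0 < P x / 2 by rewrite divr_gt0.
  have k0 : 0 < k by apply: le_lt_trans Kk; rewrite divr_ge0 // ltW.
  have : F x0 - F x + 1 < k * P y.
    apply: le_lt_trans (ler_norm _) _.
    move: Kk; rewrite /K ltr_pdivrMr // => /lt_trans; apply.
    by rewrite ltr_pM2l.
  by move: Fy; lra.
exists (Num.max 1 (M + 1)); first by rewrite lt_max ltr01.
by move=> x xe; apply: MP => //; rewrite lt_max ltrDl ltr01 orbT.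
Qed.

(** A minimizer over the closed ball has value at most [F x0], the value at the
    centre, so by the previous lemma it cannot lie on the sphere. *)
Lemma penalty_interior_min F P x0 (e : R) : 0 < e ->
    continuous F -> continuous P -> (forall x, 0 <= P x) -> P x0 = 0 ->
    (forall x, `|x - x0| = e -> P x = 0 -> F x0 < F x) ->
  exists2 k, 0 < k & exists2 x, `|x - x0| < e &
    \forall y \near x, F x + k * P x <= F y + k * P y.
Proof.
move=> e0 cF cP P0 Px0 FP; have [k k0 kS] := penalty_sphere cF cP P0 FP.
exists k => //; pose B := closed_ball_ Num.Def.normr x0 e.
have cB : compact B.
  apply: bounded_closed_compact; last exact: closed_closed_ball_.
  exists (`|x0| + e); split; first exact: num_real.
  move=> M /ltW eM x /= xe; apply: le_trans eM.
  by rewrite -(subrK x0 x) (le_trans (ler_normD _ _)) // addrC lerD2l distrC.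
have Bx0 : B x0 by rewrite /B /closed_ball_ /= subrr normr0 ltW.
have [||x /set_mem Bx xmin] := @EVT_min_rV _ _ (fun x => F x + k * P x) B _ cB.
- by exists x0.
- apply: continuous_subspaceT => x.
  apply: (@continuousD _ _ _ F (fun x => k * P x)); first exact: cF.
  by apply: continuousM; [exact: cst_continuous|exact: cP].
have xe : `|x - x0| < e.
  move: (Bx); rewrite /B /closed_ball_ /= distrC le_eqVlt => /orP[/eqP xe|//].
  have := kS x xe; rewrite ltNge => /negP[].
  by have := xmin x0 (mem_set Bx0); rewrite Px0 mulr0 addr0.
exists x => //.
have : \forall y \near x, `|y - x0| < e.
  exact: cvgr_lt _ (@continuous_dist x0 x) _ xe.
apply: filterS => y ye; apply: xmin; apply/mem_set.
by rewrite /B /closed_ball_ /= distrC ltW.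
Qed.

End Penalty.

(** * Penalization of the nonlinear program *)

Section NLP.
Variables (R : realType) (n p m : nat).
Variables (f : 'rV[R]_n -> R) (h : 'I_p -> 'rV[R]_n -> R)
  (g : 'I_m -> 'rV[R]_n -> R).
Hypotheses (df : twice_diff f) (dh : forall j, twice_diff (h j))
  (dg : forall i, twice_diff (g i)).

(** The Lagrangian along a line has two second-order jets, one from its own
    Hessian and one assembled from those of [f], [h] and [g]; they agree. *)
Lemma qform_hess_lagrangian x mu omega d :
  qform (hess (fun z => lagrangian f h g z mu omega) x) d =
  qform (hess f x) d + \sum_j mu 0 j * qform (hess (h j) x) d
    + \sum_i omega 0 i * qform (hess (g i) x) d.
Proof.
have -> : (fun z => lagrangian f h g z mu omega) =
    (fun z => f z + \sum_j mu 0 j * h j z + \sum_i omega 0 i * g i z).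
  apply/funext => z; rewrite /lagrangian.
  by congr (_ + _ + _); apply: eq_bigr => i _; rewrite mulrC.
have dL : twice_diff
    (fun z => f z + \sum_j mu 0 j * h j z + \sum_i omega 0 i * g i z).
  apply: twice_diffD; first apply: twice_diffD => //.
    by apply: twice_diff_sum => j; exact: twice_diffZ.
  by apply: twice_diff_sum => i; exact: twice_diffZ.
have J1 := jet2_line x d dL.
have J2 := jet2_add (jet2_add (jet2_line x d df)
     (jet2_sum (fun j => jet2_scale (mu 0 j) (jet2_line x d (dh j)))))
     (jet2_sum (fun i => jet2_scale (omega 0 i) (jet2_line x d (dg i)))).
have [_ _ E] := jet2_unique J1 J2.
exact: E.
Qed.

Definition quartic (c x : 'rV[R]_n) : R := \sum_i (x 0 i - c 0 i) ^+ 4.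

Definition infeasibility (x : 'rV[R]_n) : R :=
  \sum_j h j x ^+ 2 + \sum_i pospart (g i x) ^+ 3.

Lemma jet2_penalized k c x d :
  jet2 (fun t => f (x + t *: d) + quartic c (x + t *: d)
                 + k * infeasibility (x + t *: d))
    (f x + quartic c x + k * infeasibility x)
    (dot (grad f x + \sum_j (k * (2 * h j x)) *: grad (h j) x
          + \sum_i (k * (3 * pospart (g i x) ^+ 2)) *: grad (g i) x
          + \row_i (4 * (x 0 i - c 0 i) ^+ 3)) d)
    (qform (hess f x) d
     + \sum_j (k * (2 * h j x)) * qform (hess (h j) x) d
     + \sum_i (k * (3 * pospart (g i x) ^+ 2)) * qform (hess (g i) x) d
     + \sum_i 12 * (x 0 i - c 0 i) ^+ 2 * d 0 i ^+ 2
     + k * (\sum_j 2 * dot (grad (h j) x) d ^+ 2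
            + \sum_i 6 * pospart (g i x) * dot (grad (g i) x) d ^+ 2)).
Proof.
have Jq i : jet2 (fun t => (x + t *: d) 0 i - c 0 i) (x 0 i - c 0 i) (d 0 i) 0.
  have -> : (fun t => (x + t *: d) 0 i - c 0 i) =
            (fun t => (x 0 i - c 0 i) + t * d 0 i).
    by apply/funext => t; rewrite !mxE addrAC.
  exact: jet2_affine.
have := jet2_add (jet2_add (jet2_line x d df)
    (jet2_sum (fun i => jet2_exp 2 (Jq i))))
  (jet2_scale k (jet2_add
    (jet2_sum (fun j => jet2_exp 0 (jet2_line x d (dh j))))
    (jet2_sum (fun i => jet2_pospart_cube (jet2_line x d (dg i)))))).
congr (jet2 _ _ _ _).
- rewrite !dotDl !dot_suml.
  have -> : \sum_j dot ((k * (2 * h j x)) *: grad (h j) x) d =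
      k * \sum_j 2 * h j x ^+ 1 * dot (grad (h j) x) d.
    by rewrite mulr_sumr; apply: eq_bigr => j _; rewrite dotZl; ring.
  have -> : \sum_i dot ((k * (3 * pospart (g i x) ^+ 2)) *: grad (g i) x) d =
      k * \sum_i 3 * pospart (g i x) ^+ 2 * dot (grad (g i) x) d.
    by rewrite mulr_sumr; apply: eq_bigr => j _; rewrite dotZl; ring.
  have -> : dot (\row_i (4 * (x 0 i - c 0 i) ^+ 3)) d =
      \sum_i 4 * (x 0 i - c 0 i) ^+ 3 * d 0 i.
    by rewrite /dot; apply: eq_bigr => i _; rewrite mxE.
  by ring.
- have -> : \sum_j k * (2 * h j x) * qform (hess (h j) x) d =
      k * \sum_j 2 * h j x * qform (hess (h j) x) d.
    by rewrite mulr_sumr; apply: eq_bigr => j _; ring.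
  have -> : \sum_i k * (3 * pospart (g i x) ^+ 2) * qform (hess (g i) x) d =
      k * \sum_i 3 * pospart (g i x) ^+ 2 * qform (hess (g i) x) d.
    by rewrite mulr_sumr; apply: eq_bigr => i _; ring.
  pose H := \sum_j 2 * h j x * qform (hess (h j) x) d.
  pose G := \sum_i 3 * pospart (g i x) ^+ 2 * qform (hess (g i) x) d.
  pose H' := \sum_j 2 * dot (grad (h j) x) d ^+ 2.
  pose G' := \sum_i 6 * pospart (g i x) * dot (grad (g i) x) d ^+ 2.
  pose Q := \sum_i 12 * (x 0 i - c 0 i) ^+ 2 * d 0 i ^+ 2.
  transitivity (qform (hess f x) d + Q + k * (H' + H + (G' + G))); last first.
    by rewrite /H /G /H' /G' /Q; ring.
  rewrite /H /G /H' /G' /Q -!big_split /=.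
  by congr (_ + _ + k * (_ + _)); apply: eq_bigr => i _; ring.
Qed.

(** The necessary conditions of the penalized function, with the factors of
    the constraint gradients read as Lagrange multipliers.  The last bracket
    collects the terms in which the penalties are differentiated twice. *)
Lemma penalized_local_min k c x :
    (\forall y \near x, f x + quartic c x + k * infeasibility x
                      <= f y + quartic c y + k * infeasibility y) ->
  let mu := \row_j (k * (2 * h j x)) in
  let omega := \row_i (k * (3 * pospart (g i x) ^+ 2)) in
  grad f x + \sum_j mu 0 j *: grad (h j) x
    + \sum_i omega 0 i *: grad (g i) x
    = - \row_i (4 * (x 0 i - c 0 i) ^+ 3) /\
  forall d, 0 <= qform (hess (fun z => lagrangian f h g z mu omega) x) d
     + \sum_i 12 * (x 0 i - c 0 i) ^+ 2 * d 0 i ^+ 2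
     + k * (\sum_j 2 * dot (grad (h j) x) d ^+ 2
            + \sum_i 6 * pospart (g i x) * dot (grad (g i) x) d ^+ 2).
Proof.
move=> xmin mu omega.
have muE j : mu 0 j = k * (2 * h j x) by rewrite mxE.
have omegaE i : omega 0 i = k * (3 * pospart (g i x) ^+ 2) by rewrite mxE.
have line d : \forall t \near (0 : R),
    f (x + 0 *: d) + quartic c (x + 0 *: d) + k * infeasibility (x + 0 *: d)
    <= f (x + t *: d) + quartic c (x + t *: d) + k * infeasibility (x + t *: d).
  rewrite scale0r addr0.
  have L : (fun t : R => x + t *: d) @ 0 --> x.
    rewrite -[in X in _ --> X](addr0 x) -[in X in _ --> X](scale0r d).
    apply: cvgD; first exact: cvg_cst.
    by apply: cvgZr_tmp; exact: cvg_id.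
  exact: L xmin.
have crit d := jet2_local_min (jet2_penalized k c x d) (line d).
split=> [|d].
  apply/eqP; rewrite -addr_eq0; apply/eqP/dot_eq0 => d.
  rewrite -[RHS](crit d).1; congr (dot (_ + _ + _ + _) d).
    by apply: eq_bigr => j _; rewrite muE.
  by apply: eq_bigr => j _; rewrite omegaE.
have [_ curv] := crit d; rewrite qform_hess_lagrangian.
under [\sum_j mu 0 j * _]eq_bigr do rewrite muE.
under [\sum_i omega 0 i * _]eq_bigr do rewrite omegaE.
exact: curv.
Qed.

Lemma continuous_quartic c : continuous (quartic c).
Proof.
apply: (@continuous_sum _ _ _ (fun i x => (x 0 i - c 0 i) ^+ 4)) => i x.
apply: (@continuous_comp _ _ _ (fun y : 'rV[R]_n => y 0 i - c 0 i)
  (fun s : R => s ^+ 4)).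
  by apply: continuousB; [exact: coord_continuous|exact: cst_continuous].
exact: exprn_continuous.
Qed.

Lemma quartic_ge0 (c x : 'rV[R]_n) : 0 <= quartic c x.
Proof. by apply: sumr_ge0 => i _; rewrite -[4%N]/(2 * 2)%N exprM sqr_ge0. Qed.

Lemma quartic_eq0 (c x : 'rV[R]_n) : quartic c x = 0 -> x = c.
Proof.
move=> /eqP; rewrite psumr_eq0 => [/allP cx|i _]; last first.
  by rewrite -[4%N]/(2 * 2)%N exprM sqr_ge0.
apply/rowP => i; have := cx i (mem_index_enum _).
by rewrite expf_eq0 /= subr_eq0 => /eqP.
Qed.

Lemma quarticcc (c : 'rV[R]_n) : quartic c c = 0.
Proof. by rewrite /quartic big1 // => i _; rewrite subrr expr0n. Qed.

Lemma continuous_infeasibility : continuous infeasibility.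
Proof.
have ch j := twice_diff_continuous (dh j).
have cg i := twice_diff_continuous (dg i).
move=> x; apply: (@continuousD _ _ _ (fun x => \sum_j h j x ^+ 2)
   (fun x => \sum_i pospart (g i x) ^+ 3)).
  apply: (@continuous_sum _ _ _ (fun j x => h j x ^+ 2)) => j y.
  apply: (@continuous_comp _ _ _ (h j) (fun s : R => s ^+ 2)); first exact: ch.
  exact: exprn_continuous.
apply: (@continuous_sum _ _ _ (fun i x => pospart (g i x) ^+ 3)) => i y.
apply: (@continuous_comp _ _ _ (g i) (fun t => pospart t ^+ 3)).
  exact: cg.
exact: is_derive_continuous (is_derive_pospart_cube _).
Qed.

Lemma infeasibility_ge0 x : 0 <= infeasibility x.
Proof.
rewrite addr_ge0 // sumr_ge0 // => i _.
  exact: sqr_ge0.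
by rewrite exprn_ge0 ?pospart_ge0.
Qed.

Lemma infeasibility_eq0 x : infeasibility x = 0 <-> feasible h g x.
Proof.
have h0 j : 0 <= h j x ^+ 2 by exact: sqr_ge0.
have g0 i : 0 <= pospart (g i x) ^+ 3 by rewrite exprn_ge0 ?pospart_ge0.
split=> [/eqP|[hx gx]]; last first.
  rewrite /infeasibility !big1 ?addr0 // => i _; last by rewrite hx expr0n.
  by rewrite /pospart max_l ?expr0n.
rewrite paddr_eq0 ?sumr_ge0 // => /andP[].
rewrite !psumr_eq0 // => /allP hx /allP gx; split=> i.
  by have := hx i (mem_index_enum _); rewrite expf_eq0 => /eqP.
have := gx i (mem_index_enum _); rewrite expf_eq0 /= /pospart => /eqP E.
by rewrite -E le_max lexx orbT.
Qed.

Lemma near_constraints xbar (e : R) : feasible h g xbar -> 0 < e ->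
  \forall x \near xbar, [/\ forall j, `|h j x| <= e,
    forall i, pospart (g i x) <= e
    & forall i, i \notin active_set g xbar -> g i x < 0].
Proof.
move=> [hx gx] e0.
have ch j := twice_diff_continuous (dh j).
have cg i := twice_diff_continuous (dg i).
have Nh j : \forall x \near xbar, `|h j x| <= e.
  have hj : h j y @[y --> xbar] --> (0 : R) by rewrite -(hx j); exact: ch.
  exact: cvgr0_norm_le hj _ e0.
have Ng i : \forall x \near xbar, g i x < e.
  exact: cvgr_lt _ (cg i xbar) _ (le_lt_trans (gx i) e0).
have Na i : \forall x \near xbar, i \notin active_set g xbar -> g i x < 0.
  have [ia|ia] := boolP (i \in active_set g xbar).
    by apply: (@filterE _ (nbhs xbar) (nbhs_filter xbar)) => x /negP[].
  have gi : g i xbar < 0 by move: ia; rewrite inE lt_neqAle gx andbT.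
  by apply: filterS (cvgr_lt _ (cg i xbar) _ gi) => x gix _.
apply: filterS3 (filter_forall _ Nh) (filter_forall _ Ng) (filter_forall _ Na)
  => x hx' gx' ax; split=> // i.
by rewrite ge_max ltW // ltW.
Qed.

(** Fixing the tolerance in advance keeps limits out of the argument, and lets
    the monotone sequence of tolerances be prescribed afterwards. *)
Lemma near_SAKKT2 xbar (eps : R) : local_minimizer f h g xbar -> 0 < eps ->
  exists (x : 'rV[R]_n) (mu : 'rV[R]_p) (omega : 'rV[R]_m),
    [/\ `|x - xbar| < eps, forall i, 0 <= omega 0 i,
    AKKT_at f h g x mu omega eps
    & forall d, Stilde h g x xbar omega d ->
      - eps * enorm d ^+ 2 <=
        qform (hess (fun z => lagrangian f h g z mu omega) x) d].
Proof.
move=> [xfeas xmin] eps0.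
(* [r] is an entrywise bound that controls the Euclidean norm in each of the
   dimensions [n], [p] and [m]. *)
pose r := eps / (n + p + m).+1%:R.
have r0 : 0 < r by rewrite divr_gt0.
have r_le (q : nat) : (q <= n + p + m)%N -> r <= eps / q.+1%:R.
  move=> qN; rewrite ler_wpM2l ?(ltW eps0) // lef_pV2 ?posrE ?ltr0n //.
  by rewrite ler_nat.
pose good x := (feasible h g x -> f xbar <= f x) /\
  [/\ forall j, `|h j x| <= r, forall i, pospart (g i x) <= r
    & forall i, i \notin active_set g xbar -> g i x < 0].
have /nbhs_ballP[s /= s0 Ns] : \forall x \near xbar, good x.
  by apply: filterS2 xmin (near_constraints xfeas r0) => x.
(* The radius keeps the ball inside the neighbourhood of [good] points; being
   at most 1, its powers are at most [e], and then 12 covers the coefficients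
   4 and 12 of the derivatives of the quartic term. *)
pose e := Num.min (s / 2) (Num.min 1 (r / 12)).
have e0 : 0 < e by rewrite !lt_min ltr01 !divr_gt0.
have es : e < s.
  apply: (@le_lt_trans _ _ (s / 2)); first by rewrite ge_min lexx.
  by rewrite ltr_pdivrMr // ltr_pMr // ltr1n.
have e1 : e <= 1 by rewrite !ge_min lexx orbT.
have er : 12 * e <= r.
  by rewrite mulrC -ler_pdivlMr // !ge_min lexx !orbT.
have {}Ns x : `|x - xbar| <= e -> good x.
  move=> xe; apply: Ns; rewrite -ball_normE /ball_ /= distrC.
  exact: le_lt_trans es.
pose F x := f x + quartic xbar x.
have cF : continuous F.
  move=> x; apply: (@continuousD _ _ _ f (quartic xbar)).
    exact: twice_diff_continuous.
  exact: continuous_quartic.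
have [x xe Px0|k k0 [x xe xmin']] := penalty_interior_min e0 cF
  continuous_infeasibility infeasibility_ge0
  ((infeasibility_eq0 xbar).2 xfeas) _.
  have [fx _] : good x by apply: Ns; rewrite xe.
  have {}fx := fx ((infeasibility_eq0 x).1 Px0).
  rewrite /F quarticcc addr0; apply: (le_lt_trans fx).
  rewrite ltrDl lt_neqAle quartic_ge0 andbT eq_sym.
  apply/eqP => /quartic_eq0 xx.
  by move: xe e0; rewrite xx subrr normr0 => <-; rewrite ltxx.
have [gradL hessL] := penalized_local_min xmin'.
have [_ [hx gx ax]] := Ns x (ltW xe).
have coord i : `|x 0 i - xbar 0 i| <= e.
  have := coord_le_norm (x - xbar) i; rewrite !mxE => /le_trans; apply.
  exact: ltW.
have pos_omega i : 0 <= k * (3 * pospart (g i x) ^+ 2).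
  by apply: mulr_ge0; [exact: ltW|apply: mulr_ge0 => //; exact: sqr_ge0].
exists x, (\row_j (k * (2 * h j x))), (\row_i (k * (3 * pospart (g i x) ^+ 2))).
split.
- apply: lt_le_trans xe _; apply: (@le_trans _ _ r); first lra.
  by rewrite -[leRHS]divr1; exact: (r_le 0%N).
- by move=> i; rewrite mxE.
- split.
  + rewrite gradL; apply: enorm_le => [|i]; first exact: ltW.
    apply: (@le_trans _ _ r); last by apply: r_le; rewrite -addnA leq_addr.
    rewrite !mxE normrN normrM normrX (ger0_norm (_ : 0 <= 4)) //.
    apply: le_trans er.
    have := coord i; have := normr_ge0 (x 0 i - xbar 0 i).
    move: `|_| => z z0 ze.
    have : z ^+ 3 <= e.
      rewrite exprS; apply: (le_trans _ ze).
      by rewrite ler_piMr // exprn_ile1 // (le_trans ze).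
    lra.
  + apply: enorm_le => [|j]; first exact: ltW.
    rewrite mxE; apply: le_trans (hx j) (r_le _ _).
    by rewrite addnAC leq_addl.
  + apply: enorm_le => [|i]; first exact: ltW.
    rewrite mxE -/(pospart _) ger0_norm ?pospart_ge0 //.
    by apply: le_trans (gx i) (r_le _ _); rewrite leq_addl.
  + apply: enorm_le => [|i]; first exact: ltW.
    apply: (@le_trans _ _ r); last by apply: r_le; rewrite leq_addl.
    rewrite !mxE; have := pos_omega i; have := gx i; rewrite /pospart.
    have [gi|gi] := leP 0 (g i x).
      move=> gr o0; rewrite min_r ?normrN ?ger0_norm //.
      by apply: le_trans o0; rewrite oppr_le0.
    by rewrite expr0n !mulr0 min_l ?normr0 // oppr_ge0 ltW.
- move=> d [Sh Sg]; have := hessL d.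
  have -> : \sum_j 2 * dot (grad (h j) x) d ^+ 2 = 0.
    by rewrite big1 // => j _; rewrite Sh expr0n mulr0.
  have -> : \sum_i 6 * pospart (g i x) * dot (grad (g i) x) d ^+ 2 = 0.
    rewrite big1 // => i _; have [gi|gi] := leP (g i x) 0.
      by rewrite /pospart max_l // mulr0 mul0r.
    (* A violated inequality is active at [xbar] and has a positive multiplier,
       so [Stilde] applies to it. *)
    rewrite Sg ?expr0n ?mulr0 //.
      by apply: contraTT gi => /ax; rewrite -leNgt => /ltW.
    by rewrite mxE !mulr_gt0 // /pospart lt_max gi orbT.
  rewrite addr0 mulr0 addr0 -lerBlDr sub0r; apply: le_trans.
  rewrite mulNr lerN2 enorm_sqr mulr_sumr; apply: ler_sum => i _.
  rewrite ler_wpM2r ?sqr_ge0 // -real_normK ?num_real //.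
  have := coord i; have := normr_ge0 (x 0 i - xbar 0 i).
  move: `|_| => z z0 ze.
  have : z ^+ 2 <= e.
    by rewrite expr2; apply: (le_trans _ ze); rewrite ler_piMr // (le_trans ze).
  have : r <= eps by rewrite -[leRHS]divr1; exact: (r_le 0%N).
  lra.
Qed.

End NLP.

(** * The sequential conditions *)

Theorem theorem3p4 (R : realType) (n p m : nat) (f : 'rV[R]_n -> R)
    (h : 'I_p -> 'rV[R]_n -> R) (g : 'I_m -> 'rV[R]_n -> R)
    (f_C2 : twice_cont_diff f)
    (h_C2 : forall j, twice_cont_diff (h j))
    (g_C2 : forall i, twice_cont_diff (g i))
    (xbar : 'rV[R]_n) :
  local_minimizer f h g xbar -> Stilde_SAKKT2 f h g xbar.
Proof.
move=> xmin.
have eps0 (k : nat) : 0 < harmonic k :> R by rewrite invr_gt0.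
have pick (k : nat) := near_SAKKT2 (twice_cont_diffW f_C2)
  (fun j => twice_cont_diffW (h_C2 j)) (fun i => twice_cont_diffW (g_C2 i))
  xmin (eps0 k).
have {pick} [x /choice[mu /choice[omega P]]] := choice pick.
exists x, mu, omega, harmonic; split.
- by split=> // k i; have [_ /(_ i)] := P k.
- apply/cvgrPdist_le => e e0.
  apply: filterS (cvgr_lt _ (@cvg_harmonic R) _ e0) => k ke.
  by have [xk _ _ _] := P k; rewrite distrC (le_trans (ltW xk)) // ltW.
- split; last exact: cvg_harmonic.
  by move=> i j ij; rewrite /harmonic lef_pV2 ?posrE // ler_nat.
- by move=> k; have [] := P k.
- by move=> k d; have [_ _ _] := P k; apply.
Qed.
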